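(* Let $(\Omega,\mathcal{F})$ be a measurable space, let $\mathcal{P}$ be the set of all probability measures on $(\Omega,\mathcal{F})$, let $n\in\mathbb{N}$ (with $n\ge1$), let $f_1,\ldots,f_n\colon\Omega\to\mathbb{R}$ be measurable functions, let $a_1,\ldots,a_n\in\mathbb{R}$, and let $$\mathcal{M}=\Big\{p\in\mathcal{P}\,\Big|\,f_i\in L^1(p)\text{ with }\int_\Omega f_i\,\mathrm{d}p=a_i\text{ for all }i=1,\ldots,n\Big\}.$$ Then, for $p\in\mathcal{M}$, the following statements are equivalent. (i) $p$ is an extreme point of $\mathcal{M}$. (ii) There exist $m\in\mathbb{N}$, coefficients $\alpha_1,\ldots,\alpha_m>0$, and pairwise disjoint $p$-atoms $A_1,\ldots,A_m\in\mathcal{F}$ such that $p=\sum_{j=1}^m\alpha_j\,p_{A_j}$ and the $(n+1)\times m$ matrix whose $j$-th column is $$v_j:=\big(1,f_1(A_j),\ldots,f_n(A_j)\big)^\top\in\mathbb{R}^{n+1},\qquad j=1,\ldots,m,$$ has rank $m$, i.e., the vectors $v_1,\ldots,v_m$ are linearly independent. (In particular, extremality forces $m\leq n+1$.) (iii) $p$ is $\ll$-minimal in $\mathcal{M}$. (iv) For every $p'\in\mathcal{M}\setminus\{p\}$, every $q\in\mathcal{M}$ with $p\ll q$ and $p'\ll q$, and every convex function $\varphi\colon[0,\infty)\to\mathbb{R}$ satisfying $$\varphi(1)=0,\quad\varphi'_+(0)=-\infty,\quad D_\varphi(p\,\|\,q)<\infty,\quad D_\varphi(p'\,\|\,q)<\infty,$$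 one has $$\lim_{\lambda\uparrow1}\frac{D_\varphi(\lambda p+(1-\lambda)p'\,\|\,q)-D_\varphi(p\,\|\,q)}{1-\lambda}=-\infty.$$ In particular, $\lambda=1$ is a strict local maximizer of the map $[0,1]\to[0,\infty)$, $\lambda\mapsto D_\varphi(\lambda p+(1-\lambda)p'\,\|\,q)$.
   Context: $L^1(p)$ is the set of measurable $f\colon\Omega\to\mathbb{R}$ with $\int_\Omega|f|\,\mathrm{d}p<\infty$. An extreme point of a convex set $\mathcal{C}$ of probability measures is a $p\in\mathcal{C}$ such that $p=\lambda p'+(1-\lambda)p''$ with $p',p''\in\mathcal{C}$ and $\lambda\in(0,1)$ implies $p'=p''=p$. We write $p\ll q$ for absolute continuity and $\frac{\mathrm{d}p}{\mathrm{d}q}\colon\Omega\to[0,\infty)$ for the Radon-Nikodym density. An element $p\in\mathcal{M}$ is $\ll$-minimal in $\mathcal{M}$ if there exists no $p'\in\mathcal{M}\setminus\{p\}$ with $p'\ll p$. A set $A\in\mathcal{F}$ is a $p$-atom if $p(A)>0$ and every $B\in\mathcal{F}$ with $B\subseteq A$ satisfies $p(B)\in\{0,p(A)\}$. For a $p$-atom $A$, let $p_A(B):=\frac{p(A\cap B)}{p(A)}$ for $B\in\mathcal{F}$. Then $p_A$ is a $\{0,1\}$-valued probability measure, every measurable function $\Omega\to\mathbb{R}$ is $p_A$-a.s. constant, and $f_i(A)$ denotes the constant value that $f_i$ takes $p_A$-a.s. For a convex function $\varphi\colon[0,\infty)\to\mathbb{R}$ with $\varphi(1)=0$ and $p,q\in\mathcal{P}$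 with $p\ll q$, the $\varphi$-divergence of $p$ with respect to $q$ is $D_\varphi(p\,\|\,q):=\int_\Omega\varphi\big(\frac{\mathrm{d}p}{\mathrm{d}q}\big)\,\mathrm{d}q$. Moreover, $\varphi'_+(0):=\lim_{s\downarrow0}\frac{\varphi(s)-\varphi(0)}{s}\in[-\infty,\infty)$. The point $\lambda=1$ is a strict local maximizer of $f\colon[0,1]\to\mathbb{R}$ if there is $\delta>0$ with $f(\lambda)<f(1)$ for all $\lambda\in[0,1]\cap(1-\delta,1)$. *)

(* Defs.v *)
From HB Require Import structures.
From mathcomp Require Import all_boot all_order all_algebra.
From mathcomp Require Import all_classical all_reals all_analysis.
From mathcomp Require Import giry.

Set Implicit Arguments.
Unset Strict Implicit.
Unset Printing Implicit Defensive.

Import Order.TTheory GRing.Theory Num.Theory.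
Import numFieldNormedType.Exports.

Local Open Scope classical_set_scope.
Local Open Scope ring_scope.
Local Open Scope ereal_scope.

(* Two terms of type [probability T R] may differ on non-measurable sets, so
   equality of probability measures on (T, measurable) is always stated with
   the library's [measure_eq] (notation ≡μ), never with [=]. *)

Section mixture.
Context d (T : measurableType d) (R : realType).

(* The weight is clamped to [0, 1] so that [mixture l p q] is a probability
   measure for every real [l]; only l in [0, 1] is meaningful, see
   [mixtureE]. *)
Definition clamp01 (l : R) : R := Num.max 0%R (Num.min l 1%R).

Lemma clamp01_ge0 (l : R) : (0 <= clamp01 l)%R.
Proof. by rewrite /clamp01 le_max lexx. Qed.

Lemma onem_clamp01_ge0 (l : R) : (0 <= 1 - clamp01 l)%R.
Proof. by rewrite subr_ge0 /clamp01 ge_max ler01 ge_min lexx orbT. Qed.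

Lemma clamp01_id (l : R) : (0 <= l <= 1)%R -> clamp01 l = l.
Proof. by case/andP=> l0 l1; rewrite /clamp01 min_l// max_r. Qed.

Definition mixture (l : R) (p q : probability T R) : set T -> \bar R :=
  measure_add (mscale (NngNum (clamp01_ge0 l)) p)
              (mscale (NngNum (onem_clamp01_ge0 l)) q).

HB.instance Definition _ l p q := Measure.on (mixture l p q).

Lemma mixture_clampE l p q (A : set T) :
  mixture l p q A = (clamp01 l)%:E * p A + (1 - clamp01 l)%:E * q A.
Proof. exact: measure_addE. Qed.

Let mixture_setT l p q : mixture l p q setT = 1.
Proof.
by rewrite mixture_clampE !probability_setT !mule1 -EFinD subrKC.
Qed.

HB.instance Definition _ l p q :=
  Measure_isProbability.Build _ _ _ (mixture l p q) (mixture_setT l p q).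

Lemma mixtureE l p q (A : set T) : (0 <= l <= 1)%R ->
  mixture l p q A = l%:E * p A + (1 - l)%:E * q A.
Proof. by move=> l01; rewrite mixture_clampE clamp01_id. Qed.

End mixture.

Section convex_sets_of_probabilities.
Context d (T : measurableType d) (R : realType).
Implicit Types (C : set (probability T R)) (p : probability T R).

Definition extreme_point C p : Prop :=
  C p /\ forall (p' p'' : probability T R) (l : R),
    C p' -> C p'' -> (0 < l < 1)%R ->
    p ≡μ mixture l p' p'' -> p' ≡μ p /\ p'' ≡μ p.

Definition ll_minimal C p : Prop :=
  C p /\ ~ exists p' : probability T R, [/\ C p', ~ (p' ≡μ p) & p' `<< p].

End convex_sets_of_probabilities.

Definition moment_set d (T : measurableType d) (R : realType) (n : nat)
    (f : 'I_n -> T -> R) (a : 'I_n -> R) : set (probability T R) :=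
  [set p | forall i, p.-integrable setT (EFin \o f i) /\
                     \int[p]_x (f i x)%:E = (a i)%:E].

Section atoms.
Context d (T : measurableType d) (R : realType).
Variable p : probability T R.

Definition is_atom (A : set T) : Prop :=
  [/\ measurable A, 0 < p A &
      forall B, measurable B -> B `<=` A -> p B = 0 \/ p B = p A].

Definition cond_prob (A B : set T) : \bar R := p (A `&` B) / p A.

(* If A is a p-atom and g is measurable, exactly one c has this property. *)
Definition atom_value (A : set T) (g : T -> R) : R :=
  get [set c : R | cond_prob A (g @^-1` [set c]) = 1].

Definition atom_matrix n m (f : 'I_n -> T -> R) (A : 'I_m -> set T) :
    'M[R]_(1 + n, m) :=
  col_mx (const_mx 1%R) (\matrix_(i < n, j < m) atom_value (A j) (f i)).

Definition atomic_decomposition n (f : 'I_n -> T -> R)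
    m (alpha : 'I_m -> R) (A : 'I_m -> set T) : Prop :=
  [/\ (forall j, (0 < alpha j)%R),
      (forall j, is_atom (A j)),
      trivIset setT A,
      (forall B, measurable B ->
         p B = \sum_(j < m) (alpha j)%:E * cond_prob (A j) B) &
      \rank (atom_matrix f A) = m].

End atoms.

Section phi_divergence.
Context d (T : measurableType d) (R : realType).

(* [Radon_Nikodym_SigmaFinite.f p q] is the everywhere finite and nonnegative
   version of the density dp/dq (the charge version 'd p '/d q may be negative
   on a null set), so only the values of phi on [0, +oo[ are used.
   Meaningful when p `<< q. *)
Definition phi_divergence (phi : R -> R) (p q : probability T R) : \bar R :=
  \int[q]_x (phi (fine (Radon_Nikodym_SigmaFinite.f p q x)))%:E.

Definition right_derivative0_is_Ny (phi : R -> R) : Prop :=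
  ((phi s - phi 0) / s)%:E @[s --> (0:R)^'+] --> -oo.

Definition admissible (M : set (probability T R)) (p p' q : probability T R)
    (phi : R -> R) : Prop :=
  [/\ M p' /\ ~ (p' ≡μ p),
      [/\ M q, p `<< q & p' `<< q],
      convex_function (E := R^o) [set s : R | (0 <= s)%R] phi,
      phi 1%R = 0%R /\ right_derivative0_is_Ny phi &
      phi_divergence phi p q < +oo /\ phi_divergence phi p' q < +oo].

Definition div_path (phi : R -> R) (p p' q : probability T R) (l : R) : \bar R
  := phi_divergence phi (mixture l p p') q.

Definition infinite_descent (phi : R -> R) (p p' q : probability T R) : Prop :=
  (div_path phi p p' q l - phi_divergence phi p q) / (1 - l)%:E
    @[l --> (1:R)^'-] --> -oo.

End phi_divergence.

Definition strict_local_max_at1 (R : realType) (F : R -> \bar R) : Prop :=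
  exists2 delta : R, (0 < delta)%R &
    forall l : R, (0 <= l <= 1)%R -> (1 - delta < l < 1)%R -> F l < F 1%R.

(* Main.v *)
Require Import Defs.
From HB Require Import structures.
From mathcomp Require Import all_boot all_order all_algebra.
From mathcomp Require Import all_classical all_reals all_analysis.
From mathcomp Require Import giry.
From mathcomp Require Import measurable_realfun.
From mathcomp Require Import ring lra.

Set Implicit Arguments.
Unset Strict Implicit.
Unset Printing Implicit Defensive.

Import Order.TTheory GRing.Theory Num.Theory.
Import numFieldNormedType.Exports.

Local Open Scope classical_set_scope.
Local Open Scope ring_scope.

(** The four statements are proved in the cycle (i) => (ii) => (iii) => (iv)
    => (i), where M is the set of probability measures with prescribed moments.

    From (i) to (ii): if h is bounded and the integrals with respect to p of h
    and of all f_i h vanish, then the measures with density 1 + h / K and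
    1 - h / K with respect to p lie in M as soon as |h| <= K, and p is their
    midpoint; so extremality forces h = 0 almost everywhere
    ([extreme_annihilator]).  Applied to step functions this says that for
    disjoint sets B_k of positive measure the vectors
    (p(B_k), int_{B_k} f_1, ..., int_{B_k} f_n) are linearly independent
    ([extreme_disjoint_indep]), hence that there are at most n + 1 such sets.
    A family of maximal cardinality consists of atoms and exhausts p
    ([maximal_nonnull_family]), and on atoms the vectors above are the multiples
    p(A_j) v_j of the columns of the matrix, so that the independence is
    exactly the rank condition.

    From (ii) to (iii): a measure p' << p is also carried by the atoms, and is
    determined by its masses p'(A_j).  If p' lies in M these masses solve the
    linear system sum_j p'(A_j) v_j = (1, a), as do the masses p(A_j), and
    the rank condition makes the solution unique ([atomic_minimal]).

    From (iii) to (iv): minimality says that p' is not dominated by p, so p'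
    charges a set on which dp/dq vanishes while dp'/dq stays between two
    positive constants ([singular_slab]).  On this set the difference quotient
    of lambda |-> phi(lambda dp/dq + (1 - lambda) dp'/dq) is a slope of phi at
    0, which goes to -oo uniformly; elsewhere convexity bounds it by the
    integrable function phi(dp'/dq) - phi(dp/dq).

    From (iv) to (i): if p is not minimal, some p' in M other than p satisfies
    p' << p.  With q = p and phi(t) = 1 - sqrt t all the hypotheses of (iv)
    hold, but D(p || p) = 0 is the minimum of the divergence, so no descent is
    possible.  A minimal p is extreme because both components of a proper
    mixture equal to p are dominated by p.

    The bounds 0 <= D < +oo along the path come from a support line of phi
    at 1 and from convexity. *)

(** * Measures given by densities *)

Section reweighting.
Local Open Scope ereal_scope.
Context d (T : measurableType d) (R : realType) (p : probability T R).
Variable g : T -> R.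
Hypotheses (g_ge0 : forall x, (0 <= g x)%R) (mg : measurable_fun setT g)
  (g_int1 : \int[p]_x (g x)%:E = 1).

Let reweight (A : set T) : \bar R := \int[p]_(x in A) (g x)%:E.

Let reweight0 : reweight set0 = 0.
Proof. exact: integral_set0. Qed.

Let reweight_ge0 A : 0 <= reweight A.
Proof. by apply: integral_ge0 => x _; rewrite lee_fin. Qed.

Let reweight_sigma_additive : semi_sigma_additive reweight.
Proof.
move=> F mF tF mUF; rewrite /reweight ge0_integral_bigcup//=.
- apply: is_cvg_ereal_nneg_natsum_cond => m _ _; exact: reweight_ge0.
- exact/measurable_EFinP/measurable_funTS.
- by move=> x _; rewrite lee_fin.
Qed.

(** The existential form avoids carrying the three hypotheses on [g] in the
    name of the new measure. *)
Lemma reweighting : exists pg : probability T R,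
  forall A, measurable A -> pg A = \int[p]_(x in A) (g x)%:E.
Proof.
pose m : measure T R := HB.pack reweight
  (isMeasure.Build _ _ _ reweight reweight0 reweight_ge0
    reweight_sigma_additive).
pose pg : probability T R := HB.pack reweight m
  (Measure_isProbability.Build _ _ _ m g_int1).
by exists pg.
Qed.

End reweighting.

Section density.
Local Open Scope ereal_scope.
Context d (T : measurableType d) (R : realType).
Implicit Types p q : probability T R.

(** The real-valued form of the density that [phi_divergence] integrates:
    its properties below hold at every point, not only almost everywhere. *)
Definition dens p q (x : T) : R := fine (Radon_Nikodym_SigmaFinite.f p q x).

Section dominated.
Variables p q : probability T R.
Hypothesis pq : p `<< q.

Lemma dens_ge0 x : (0 <= dens p q x)%R.
Proof. by rewrite fine_ge0// Radon_Nikodym_SigmaFinite.f_ge0. Qed.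

Lemma EFin_dens x : (dens p q x)%:E = Radon_Nikodym_SigmaFinite.f p q x.
Proof. by rewrite /dens fineK// Radon_Nikodym_SigmaFinite.f_fin_num. Qed.

Lemma EFin_densE : EFin \o dens p q = Radon_Nikodym_SigmaFinite.f p q.
Proof. by apply/funext => x; rewrite /= EFin_dens. Qed.

Lemma dens_integrable : q.-integrable setT (EFin \o dens p q).
Proof.
by rewrite EFin_densE; exact: Radon_Nikodym_SigmaFinite.f_integrable.
Qed.

Lemma measurable_dens : measurable_fun setT (dens p q).
Proof. by apply/measurable_EFinP; apply: measurable_int dens_integrable. Qed.

Lemma dens_integral A : measurable A -> p A = \int[q]_(x in A) (dens p q x)%:E.
Proof.
move=> mA; under eq_integral do rewrite EFin_dens.
exact: Radon_Nikodym_SigmaFinite.f_integral.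
Qed.

(** Uniqueness of the density: this is what identifies the density of a
    mixture, or of a reweighted measure, with the expected formula. *)
Lemma ae_eq_dens (g : T -> R) : measurable_fun setT g ->
  (forall A, measurable A -> p A = \int[q]_(x in A) (g x)%:E) ->
  ae_eq q setT (dens p q) g.
Proof.
move=> mg pg.
have : ae_eq q setT (EFin \o dens p q) (EFin \o g).
  apply: integral_ae_eq => //; first exact: dens_integrable.
    exact/measurable_EFinP.
  by move=> E _ mE; rewrite -pg// dens_integral.
by apply: filterS => x /= /[apply] -[].
Qed.

End dominated.

Lemma mixture_dominated p p' q l : p `<< q -> p' `<< q -> mixture l p p' `<< q.
Proof.
move=> /null_content_dominatesP pq /null_content_dominatesP p'q.
apply/null_content_dominatesP => A mA qA.
by rewrite mixture_clampE pq// p'q// !mule0 adde0.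
Qed.

Lemma dens_mixture p p' q l : p `<< q -> p' `<< q -> (0 <= l <= 1)%R ->
  ae_eq q setT (dens (mixture l p p') q)
    (fun x => l * dens p q x + (1 - l) * dens p' q x)%R.
Proof.
move=> pq p'q l01; apply: ae_eq_dens; first exact: mixture_dominated.
  apply: measurable_funD; apply: measurable_funM => //; exact: measurable_dens.
move=> A mA; rewrite [LHS](mixtureE _ _ _ l01).
have ip : q.-integrable A (EFin \o dens p q).
  by apply: integrableS (dens_integrable pq).
have ip' : q.-integrable A (EFin \o dens p' q).
  by apply: integrableS (dens_integrable p'q).
under eq_integral do rewrite EFinD !EFinM.
rewrite integralD//; [|exact: integrableZl..].
by rewrite !integralZl// -!dens_integral.
Qed.

(** The formula for nonnegative integrands is applied to the positive and the
    negative part of [f]; the upper bound on [g] gives the integrability of [f]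
    under the new measure. *)
Lemma integral_density p (pg : probability T R) (g f : T -> R) (K : R) :
  measurable_fun setT g -> (forall x, 0 <= g x <= K)%R ->
  (forall A, measurable A -> pg A = \int[p]_(x in A) (g x)%:E) ->
  p.-integrable setT (EFin \o f) ->
  pg.-integrable setT (EFin \o f) /\
  \int[pg]_x (f x)%:E = \int[p]_x (f x * g x)%:E.
Proof.
move=> mg gK pgE fi.
have mf : measurable_fun setT f.
  by apply/measurable_EFinP; apply: measurable_int fi.
have dom : pg `<< p.
  apply/null_content_dominatesP => A mA pA; rewrite pgE//.
  by rewrite null_set_integral//; exact/measurable_EFinP/measurable_funTS.
have ge0E (h : T -> R) : measurable_fun setT h -> (forall x, 0 <= h x)%R ->
    \int[pg]_x (h x)%:E = \int[p]_x (h x * g x)%:E.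
  move=> mh h0.
  have mEh : measurable_fun setT (EFin \o h) by exact/measurable_EFinP.
  have := Radon_Nikodym_SigmaFinite.change_of_variables dom (f := EFin \o h)
    _ measurableT mEh.
  move=> /= <-; last by move=> x; rewrite lee_fin.
  rewrite -EFin_densE//; apply: ae_eq_integral => //.
  - by apply: emeasurable_funM => //; exact/measurable_EFinP/measurable_dens.
  - exact/measurable_EFinP/measurable_funM.
  - have := ae_eq_dens dom mg pgE.
    by apply: filterS => x /= /[apply] ->; rewrite EFinM.
have bg : [bounded g x | x in [set: T]].
  exists K; split; first exact: num_real.
  move=> M KM x _ /=; have /andP[g0 gK'] := gK x.
  by rewrite ger0_norm// (le_trans gK')// ltW.
have g0 x : (0 <= g x)%R by have /andP[] := gK x.
split.
  apply/integrableP; split; first exact/measurable_EFinP.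
  under eq_integral do rewrite /= -/((Num.norm \o f) _).
  rewrite (ge0E (Num.norm \o f)); last 2 first.
  - exact: measurableT_comp.
  - by move=> x; exact: normr_ge0.
  exact: (integrable_lty measurableT
    (integrableMl measurableT (integrable_norm fi) mg bg)).
rewrite integralE [RHS]integralE.
have -> : (fun x => (f x)%:E) = EFin \o f by [].
have -> : (fun x => (f x * g x)%:E) = EFin \o (fun x => f x * g x)%R by [].
rewrite !funerpos !funerneg /=; congr (_ - _).
- rewrite (ge0E (f^\+)%R)//; last exact: measurable_funrpos.
  by apply: eq_integral => x _; rewrite /funrpos /= maxr_pMl// mul0r.
- rewrite (ge0E (f^\-)%R)//; last exact: measurable_funrneg.
  by apply: eq_integral => x _; rewrite /funrneg /= maxr_pMl// mul0r mulNr.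
Qed.

End density.

(** * Perturbation of extreme points *)

Section extreme_points.
Context d (T : measurableType d) (R : realType).
Variables (n : nat) (f : 'I_n -> T -> R) (a : 'I_n -> R) (p : probability T R).

Lemma moment_set_measurable : moment_set f a p ->
  forall i, measurable_fun setT (f i).
Proof.
by move=> Mp i; have [/measurable_int] := Mp i; move/measurable_EFinP.
Qed.

(** The density [1 + s * h] is nonnegative because [|s * h| <= 1], and the
    moments do not move because [h] and the [f i * h] have integral [0]. *)
Lemma tilt_in_moment_set (h : T -> R) (s : R) :
  moment_set f a p ->
  measurable_fun setT h -> (forall x, `|s * h x| <= 1) ->
  (\int[p]_x (h x)%:E = 0)%E ->
  (forall i, \int[p]_x (f i x * h x)%:E = 0)%E ->
  exists2 ps : probability T R, moment_set f a ps &
    forall A, measurable A ->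
      ps A = (p A + \int[p]_(x in A) (s * h x)%:E)%E.
Proof.
move=> Mp mh h1 h0 fh0; pose g x := 1 + s * h x.
have msh : measurable_fun setT (fun x => s * h x) by exact: measurable_funM.
have bsh : [bounded s * h x | x in [set: T]].
  by exists 1; split=> // M M1 x _ /=; rewrite (le_trans (h1 x))// ltW.
have ish A : measurable A -> p.-integrable A (fun x => (s * h x)%:E).
  move=> mA; apply: (integrableS measurableT) => //.
  apply: (measurable_bounded_integrable (f := fun x => s * h x)) => //.
  exact: fin_num_fun_lty.
have mg : measurable_fun setT g by exact: measurable_funD.
have g02 x : 0 <= g x <= 2.
  by have := h1 x; rewrite ler_norml /g => /andP[? ?]; apply/andP; split; lra.
have gA A : measurable A ->
    (\int[p]_(x in A) (g x)%:E = p A + \int[p]_(x in A) (s * h x)%:E)%E.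
  move=> mA; rewrite /g; under eq_integral do rewrite EFinD.
  rewrite integralD//; last 2 first.
  - exact: finite_measure_integrable_cst.
  - exact: ish.
  by rewrite integral_cst// mul1e.
have [s0|s0] := eqVneq s 0.
  exists p => // A mA; rewrite (eq_integral (cst 0%E)) ?integral0 ?adde0//.
  by move=> x _; rewrite s0 mul0r.
have g1 : (\int[p]_x (g x)%:E = 1)%E.
  rewrite gA// probability_setT.
  under eq_integral do rewrite EFinM.
  have ih : p.-integrable setT (EFin \o h).
    have -> : EFin \o h = (fun x => (s^-1)%:E * (s * h x)%:E)%E.
      by apply/funext => x /=; rewrite -EFinM mulrA mulVf// mul1r.
    by apply: integrableZl => //; exact: ish.
  by rewrite integralZl// h0 mule0 adde0.
have g0 x : 0 <= g x by have /andP[] := g02 x.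
have [ps psE] := reweighting g0 mg g1.
exists ps; last by move=> A mA; rewrite psE// gA.
move=> i; have [ifi ai] := Mp i.
have [ifs ->] := integral_density mg g02 psE ifi; split=> //.
have ifsh : p.-integrable setT (EFin \o (fun x => f i x * (s * h x))).
  exact: (integrableMl measurableT ifi msh bsh).
have ifh : p.-integrable setT (EFin \o (fun x => f i x * h x)).
  have -> : EFin \o (fun x => f i x * h x) =
      (fun x => (s^-1)%:E * (f i x * (s * h x))%:E)%E.
    by apply/funext => x /=; rewrite -EFinM [f i x * (s * _)]mulrCA mulKf.
  exact: integrableZl.
rewrite /g; under eq_integral do rewrite mulrDr mulr1 EFinD.
rewrite integralD// ai.
under [X in (_ + X)%E]eq_integral do rewrite mulrCA EFinM.
by rewrite integralZl// fh0 mule0 adde0.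
Qed.

(** The tilts of [p] by [h / K] and by [- h / K] are two elements of the moment
    set with midpoint [p]. *)
Lemma extreme_annihilator (h : T -> R) (K : R) :
  extreme_point (moment_set f a) p ->
  measurable_fun setT h -> 0 < K -> (forall x, `|h x| <= K) ->
  (\int[p]_x (h x)%:E = 0)%E ->
  (forall i, \int[p]_x (f i x * h x)%:E = 0)%E ->
  forall A, measurable A -> (\int[p]_(x in A) (h x)%:E = 0)%E.
Proof.
move=> [Mp ext] mh K0 hK h0 fh0.
have tilt s : `|s| = K^-1 ->
    exists2 ps : probability T R, moment_set f a ps &
    forall A, measurable A -> ps A = (p A + \int[p]_(x in A) (s * h x)%:E)%E.
  move=> sK; apply: tilt_in_moment_set => // x.
  by rewrite normrM sK mulrC ler_pdivrMr// mul1r.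
have KV0 : 0 < K^-1 by rewrite invr_gt0.
have [p1 Mp1 p1E] := tilt K^-1 (gtr0_norm KV0).
have [|p2 Mp2 p2E] := tilt (- K^-1); first by rewrite normrN gtr0_norm.
have ih A : measurable A -> p.-integrable A (EFin \o h).
  move=> mA; apply: (integrableS measurableT) => //.
  apply: measurable_bounded_integrable => //.
    exact: fin_num_fun_lty.
  exists K; split=> [|M M1 x _ /=]; first exact: num_real.
  by rewrite (le_trans (hK x))// ltW.
have ihE s A : measurable A ->
    (\int[p]_(x in A) (s * h x)%:E = s%:E * \int[p]_(x in A) (h x)%:E)%E.
  move=> mA; under eq_integral do rewrite EFinM.
  by rewrite integralZl//; exact: ih.
have [||p1p _] := ext p1 p2 2^-1 Mp1 Mp2; first by apply/andP; split; lra.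
  move=> A mA; rewrite [RHS]mixtureE; last by apply/andP; split; lra.
  rewrite p1E// p2E// !ihE//.
  have [u pu] : exists u, p A = u%:E.
    by exists (fine (p A)); rewrite fineK// fin_num_measure.
  have [v ->] : exists v, (\int[p]_(x in A) (h x)%:E)%E = v%:E.
    exists (\int[p]_(x in A) h x); rewrite /Rintegral fineK//.
    by apply: integrable_fin_num => //; exact: ih.
  rewrite pu [LHS]pu -!EFinM -!EFinD; congr EFin; lra.
move=> A mA; have := etrans (esym (p1E A mA)) (p1p A mA); rewrite ihE//.
have [u pu] : exists u, p A = u%:E.
  by exists (fine (p A)); rewrite fineK// fin_num_measure.
have [v ->] : exists v, (\int[p]_(x in A) (h x)%:E)%E = v%:E.
  exists (\int[p]_(x in A) h x); rewrite /Rintegral fineK//.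
  by apply: integrable_fin_num => //; exact: ih.
rewrite pu [RHS]pu -EFinM -EFinD => -[] /eqP.
rewrite -subr_eq0 addrAC subrr add0r mulf_eq0.
by rewrite invr_eq0 (gt_eqF K0) => /eqP ->.
Qed.

End extreme_points.

Section step_functions.
Context d (T : measurableType d) (R : realType).
Variables (m : nat) (B : 'I_m -> set T) (mB : forall k, measurable (B k)).
Implicit Types c : 'I_m -> R.

Definition step c (x : T) : R := \sum_(k < m) c k * \1_(B k) x.

Lemma measurable_step c : measurable_fun setT (step c).
Proof. by apply: measurable_sum => k; apply: measurable_funM. Qed.

Lemma norm_step_le c x : `|step c x| <= \sum_(k < m) `|c k|.
Proof.
rewrite (le_trans (ler_norm_sum _ _ _))//; apply: ler_sum => k _.
rewrite normrM ler_piMr// indicE ger0_norm ?ler0n//.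
by rewrite lern1 leq_b1.
Qed.

Lemma stepE c k x : trivIset setT B -> B k x -> step c x = c k.
Proof.
move=> tB Bkx; rewrite /step (bigD1 k)//= indicE mem_set// mulr1.
rewrite big1 ?addr0// => j jk; rewrite indicE memNset ?mulr0//.
move=> Bjx; move/trivIsetP : tB => /(_ _ _ Logic.I Logic.I jk) jk0.
by have : (B j `&` B k) x by []; rewrite jk0.
Qed.

Lemma integral_step (p : probability T R) c (u : T -> R) :
  p.-integrable setT (EFin \o u) ->
  (\int[p]_x (u x * step c x)%:E =
   (\sum_(k < m) c k * \int[p]_(x in B k) u x)%R%:E)%E.
Proof.
move=> iu.
have iB k : p.-integrable (B k) (EFin \o u) by apply: integrableS iu.
have E k x : ((c k)%:E * ((EFin \o u) \_ (B k)) x)%E =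
    (u x * (c k * \1_(B k) x))%:E.
  by rewrite epatch_indic /= -!EFinM mulrCA.
transitivity (\int[p]_x
    (\sum_(k < m) (c k)%:E * ((EFin \o u) \_ (B k)) x))%E.
  apply: eq_integral => x _; rewrite /step mulr_sumr -sumEFin.
  by apply: eq_bigr => k _; rewrite E.
rewrite integral_sum//; last first.
  move=> k; apply: integrableZl => //.
  exact: (integrable_mkcond _ (mB k)).1 (iB k).
rewrite -sumEFin; apply: eq_bigr => k _.
rewrite integralZl//; last exact: (integrable_mkcond _ (mB k)).1 (iB k).
rewrite -integral_mkcond EFinM; congr (_ * _)%E.
by rewrite /Rintegral fineK//; exact: integrable_fin_num.
Qed.

End step_functions.

Section independence.
Context d (T : measurableType d) (R : realType).
Variables (n : nat) (f : 'I_n -> T -> R) (a : 'I_n -> R) (p : probability T R).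

(** A linear relation between the vectors [(p (B k), int_(B k) f i)] is the
    same thing as a step function [h] such that [h] and the [f i * h] have
    integral [0]. *)
Lemma extreme_disjoint_indep m (B : 'I_m -> set T) (c : 'I_m -> R) :
  extreme_point (moment_set f a) p ->
  (forall k, measurable (B k)) -> trivIset setT B ->
  (forall k, (0 < p (B k))%E) ->
  \sum_(k < m) c k * fine (p (B k)) = 0 ->
  (forall i, \sum_(k < m) c k * \int[p]_(x in B k) f i x = 0) ->
  forall k, c k = 0.
Proof.
move=> ext mB tB pB c1 cf k; have [Mp _] := ext.
have h0 : (\int[p]_x (step B c x)%:E = 0)%E.
  have := integral_step mB c
    (finite_measure_integrable_cst p 1 measurableT).
  under eq_integral do rewrite mul1r.
  move=> ->; congr EFin; rewrite -[RHS]c1; apply: eq_bigr => j _.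
  by rewrite Rintegral_cst// mul1r.
have fh0 i : (\int[p]_x (f i x * step B c x)%:E = 0)%E.
  by rewrite (integral_step mB)// ?cf//; have [] := Mp i.
have K0 : 0 < 1 + \sum_(j < m) `|c j|.
  by rewrite ltr_pwDl// sumr_ge0.
have hK x : `|step B c x| <= 1 + \sum_(j < m) `|c j|.
  by rewrite (le_trans (norm_step_le _ _ _))// lerDr.
have /(_ _ (mB k)) :=
  extreme_annihilator ext (measurable_step mB c) K0 hK h0 fh0.
rewrite (eq_integral (fun=> (c k)%:E)); last first.
  by move=> x /set_mem Bkx; rewrite (stepE c tB Bkx).
rewrite integral_cst//= => /eqP; rewrite mule_eq0 => /orP[/eqP[]//|].
by rewrite gt_eqF.
Qed.

End independence.

(** * Values of measurable functions on atoms *)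

Section atom_values.
Context d (T : measurableType d) (R : realType).
Variable p : probability T R.

Lemma measureI_null (A B : set T) : measurable A -> measurable B ->
  p (A `\` B) = 0%E -> p (A `&` B) = p A.
Proof.
move=> mA mB AB0; rewrite [RHS](measureDI p mA mB).
by rewrite [X in (X + _)%E]AB0 add0e.
Qed.

Lemma measureD_null (A B : set T) : measurable A -> measurable B ->
  p (A `&` B) = p A -> p (A `\` B) = 0%E.
Proof.
move=> mA mB AB; rewrite measureD//; last first.
  by rewrite -ge0_fin_numE// fin_num_measure.
by rewrite [X in (_ - X)%E]AB subee// fin_num_measure.
Qed.

(** The level is the supremum [c] of the [t] for which [g] exceeds [t] almost
    everywhere on the atom. The sets where [g < c] and [g > c] are countable
    unions of sets cut out by a strict gap, each of which is null since an
    atom has only null and full measurable subsets. *)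
Lemma atom_level (A : set T) (g : T -> R) : is_atom p A ->
  measurable_fun setT g -> exists c, p (A `&` g @^-1` [set c]) = p A.
Proof.
move=> [mA A0 atA] mg.
have mle t : measurable (A `&` [set x | g x <= t]).
  apply: measurableI => //; rewrite -[X in measurable X]setTI.
  rewrite (_ : [set x | _] = g @^-1` `]-oo, t]); first exact: mg.
  by apply/seteqP; split=> x /=; rewrite in_itv.
have mgt t : measurable (A `&` [set x | t < g x]).
  apply: measurableI => //; rewrite -[X in measurable X]setTI.
  rewrite (_ : [set x | _] = g @^-1` `]t, +oo[); first exact: mg.
  by apply/seteqP; split=> x /=; rewrite in_itv/= andbT.
pose D := [set t | p (A `&` [set x | g x <= t]) = 0%E].
have DE t : ~ D t -> p (A `&` [set x | t < g x]) = 0%E.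
  move=> Dt.
  have [//|tA] := atA _ (mgt t) (@subIsetl _ _ _); exfalso; apply: Dt.
  rewrite /D /=.
  have -> : A `&` [set x | g x <= t] = A `\` (A `&` [set x | t < g x]).
    apply/seteqP; split=> x /=; rewrite leNgt => -[Ax gx]; split=> //.
      by case=> _ tg; rewrite tg in gx.
    by apply/negP => tg; exact: gx.
  by apply: measureD_null => //; rewrite setIA setIid.
(* An atom has positive measure, so countably many null sets do not cover it. *)
have small (F : nat -> set T) : (forall k, measurable (F k)) ->
    (forall k, p (F k) = 0%E) -> A `<=` \bigcup_k F k -> False.
  move=> mF F0 AF.
  have : p.-negligible A.
    apply: negligibleS AF _; apply: negligible_bigcup => k.
    by apply/negligibleP => //; exact: F0.
  by move/(negligibleP _ mA) => pA; move: A0; rewrite pA ltxx.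
have D0 : D !=set0.
  apply/set0P/eqP => D0.
  apply: (small (fun k => A `&` [set x | - k%:R < g x])) => [//|k|x Ax].
    by apply: DE; rewrite D0.
  exists (Num.truncn `|g x|).+1 => //; split=> //=.
  rewrite ltrNl (le_lt_trans (ler_norm _))// normrN.
  exact: truncnS_gt.
have Dub : has_ubound D.
  apply: contrapT => nub.
  apply: (small (fun k => A `&` [set x | g x <= k%:R])) => [//|k|x Ax].
    have [t Dt kt] : exists2 t, D t & k%:R < t.
      apply: contrapT => nt; apply: nub; exists k%:R => t Dt.
      by rewrite leNgt; apply/negP => kt; apply: nt; exists t.
    apply: (subset_measure0 (mle _) (mle _) _ Dt).
    by move=> y [Ay /= yk]; split=> //=; rewrite (le_trans yk)// ltW.
  exists (Num.truncn `|g x|).+1 => //; split=> //=.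
  by rewrite (le_trans (ler_norm _))// ltW// truncnS_gt.
pose c := sup D; exists c.
have mc : measurable (g @^-1` [set c]).
  by rewrite -[X in measurable X]setTI; exact: mg.
apply: measureI_null => //; apply/negligibleP; first exact: measurableD.
pose F k := A `&` [set x | g x <= c - k.+1%:R^-1].
pose G k := A `&` [set x | c + k.+1%:R^-1 < g x].
have kV0 k : 0 < k.+1%:R^-1 :> R by rewrite invr_gt0.
have arch (e : R) : 0 < e -> exists k, k.+1%:R^-1 < e.
  move=> e0; exists (Num.truncn e^-1).
  by rewrite invf_plt ?posrE// truncnS_gt.
apply: (@negligibleS _ _ _ _ (\bigcup_k F k `|` \bigcup_k G k)); last first.
  apply: negligibleU; apply: negligible_bigcup => k.
    apply/negligibleP; first exact: mle.
    have [t Dt ct] := sup_adherent (kV0 k) (conj D0 Dub).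
    apply: (subset_measure0 (mle _) (mle _) _ Dt).
    by move=> y [Ay /= yk]; split=> //=; rewrite (le_trans yk)// ltW.
  apply/negligibleP; first exact: mgt.
  apply: DE => Dc; have := ub_le_sup Dub Dc.
  by rewrite -/c gerDl leNgt kV0.
move=> x [Ax /= gc].
have [gxc|cgx|gxc] := ltgtP (g x) c; last by case: (gc gxc).
- left; have [|k kc] := arch (c - g x); first by rewrite subr_gt0.
  by exists k => //; split=> //=; rewrite lerBrDr addrC -lerBrDr ltW.
- right; have [|k kc] := arch (g x - c); first by rewrite subr_gt0.
  by exists k => //; split=> //=; rewrite -ltrBrDl.
Qed.

(** [atom_value] is a choice among the levels of [g]; [atom_level] provides
    one, hence the chosen one has full measure in the atom. *)
Lemma atom_valueP (A : set T) (g : T -> R) : is_atom p A ->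
  measurable_fun setT g ->
  p (A `&` g @^-1` [set atom_value p A g]) = p A.
Proof.
move=> atA mg; have [c pc] := atom_level atA mg; have [mA A0 _] := atA.
have Afin : p A \is a fin_num by exact: fin_num_measure.
have : cond_prob p A (g @^-1` [set atom_value p A g]) = 1%E.
  apply: (@getPex _ [set c : R | cond_prob p A (g @^-1` [set c]) = 1%E]).
  exists c; rewrite /= /cond_prob pc divee// gt_eqF//.
rewrite /cond_prob => /(congr1 (fun z => z * p A)%E).
by rewrite mul1e -muleA mulVe ?mule1// gt_eqF.
Qed.

(** Stated for every [p'] dominated by [p] since it is used both for [p] and
    for a competitor of [p] in the minimality condition. *)
Lemma atom_value_integral (p' : probability T R) (A : set T) (g : T -> R) :
  is_atom p A -> measurable_fun setT g -> p' `<< p ->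
  (\int[p']_(x in A) (g x)%:E = (atom_value p A g)%:E * p' A)%E.
Proof.
move=> atA mg /null_content_dominatesP p'p; have [mA A0 _] := atA.
have mc : measurable (g @^-1` [set atom_value p A g]).
  by rewrite -[X in measurable X]setTI; exact: mg.
have p0 : p (A `\` g @^-1` [set atom_value p A g]) = 0%E.
  by apply: measureD_null => //; exact: atom_valueP.
rewrite -integral_cst//; apply: ae_eq_integral => //.
  exact/measurable_EFinP/measurable_funTS.
exists (A `\` g @^-1` [set atom_value p A g]); split.
- exact: measurableD.
- by apply: p'p => //; exact: measurableD.
- by move=> x /= /not_implyP[Ax gx]; split=> // gx'; apply: gx; rewrite gx'.
Qed.

End atom_values.

(** * Finite families of disjoint sets and atomic decompositions *)

(** The first row is kept apart because it encodes total mass, and the others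
    encode moments. *)
Lemma rank_col_mxP (R : fieldType) (n m : nat) (u : 'rV[R]_m)
    (w : 'M[R]_(n, m)) :
  \rank (col_mx u w) = m <->
  forall c : 'I_m -> R, \sum_j c j * u 0 j = 0 ->
    (forall i, \sum_j c j * w i j = 0) -> forall j, c j = 0.
Proof.
have sl i : fintype.split (lshift n i) = inl i := unsplitK (inl i).
have sr i : fintype.split (rshift 1 i) = inr i := unsplitK (inr i).
have E (c : 'I_m -> R) k : ((\row_j c j) *m (col_mx u w)^T) 0 k =
    match fintype.split k with
    | inl _ => \sum_j c j * u 0 j | inr i => \sum_j c j * w i j end.
  rewrite mxE; case: (split_ordP k) => i ->; rewrite ?sl ?sr;
    apply: eq_bigr => j _; rewrite !mxE ?sl ?sr //.
  by rewrite (ord1 i).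
split=> [rk c cu cw j|indep].
  have fr : row_free (col_mx u w)^T by rewrite /row_free mxrank_tr rk.
  have /eqP : (\row_j c j) *m (col_mx u w)^T = 0.
    by apply/rowP => k; rewrite E mxE; case: fintype.split => [_|i].
  by rewrite mulmx_free_eq0// => /eqP/rowP/(_ j); rewrite !mxE.
rewrite -mxrank_tr; apply/eqP/inj_row_free => v v0.
have vE : \row_j v 0 j = v by apply/rowP => j; rewrite mxE.
apply/rowP => j; rewrite [RHS]mxE; apply: (indep (fun j => v 0 j)).
  by have := E (fun j => v 0 j) (lshift n 0); rewrite vE v0 mxE sl.
move=> i; have := E (fun j => v 0 j) (rshift 1 i).
by rewrite vE v0 mxE sr.
Qed.

Section disjoint_families.
Context d (T : measurableType d) (R : realType) (p : probability T R).

Definition nonnull_family m (B : 'I_m -> set T) :=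
  [/\ forall k, measurable (B k), trivIset setT B & forall k, (0 < p (B k))%E].

Lemma nonnull_family_extend m (B : 'I_m -> set T) (C : set T) :
  nonnull_family B -> measurable C -> (0 < p C)%E ->
  (forall k, B k `&` C = set0) ->
  exists B' : 'I_m.+1 -> set T, nonnull_family B'.
Proof.
move=> [mB tB pB] mC pC BC.
exists (fun k => oapp B C (unlift ord0 k)); split.
- by move=> k; case: unliftP => [j|] _ /=.
- apply/trivIsetP => i j _ _.
  case: unliftP => [i'|] -> /=; case: unliftP => [j'|] -> /=.
  + rewrite (inj_eq lift_inj) => ij.
    by move/trivIsetP : tB => /(_ _ _ Logic.I Logic.I ij).
  + by rewrite BC.
  + by rewrite setIC BC.
  + by rewrite ?eqxx.
- by move=> k; case: unliftP => [j|] _ /=.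
Qed.

Lemma bigcup_ord_measurable m (A : 'I_m -> set T) :
  (forall j, measurable (A j)) -> measurable (\bigcup_j A j).
Proof. by move=> mA; apply: fin_bigcup_measurable => // j _. Qed.

(** If a set of the family could be cut into two sets of positive measure, or
    if the complement of the union had positive measure, there would be a
    family with one more member. *)
Lemma maximal_nonnull_family m (A : 'I_m -> set T) : nonnull_family A ->
  ~ (exists B : 'I_m.+1 -> set T, nonnull_family B) ->
  (forall j, is_atom p (A j)) /\ p (~` \bigcup_j A j) = 0%E.
Proof.
move=> fA max; have [mA tA pA] := fA; split=> [j|].
  split=> // B mB BA; apply: contrapT => /not_orP[pB0 pBA]; apply: max.
  pose A' k := if k == j then B else A k.
  have A'A k : A' k `<=` A k.
    by rewrite /A'; case: eqP => [->|_]; last exact: subset_refl.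
  have D0 : (0 < p (A j `\` B))%E.
    rewrite lt0e measure_ge0 andbT; apply/eqP => D0; apply: pBA.
    by rewrite -(measureI_null (mA j) mB D0) (setIidr BA).
  apply: (nonnull_family_extend (B := A') (C := A j `\` B)) => //.
  - split.
    + by move=> k; rewrite /A'; case: ifP.
    + apply/trivIsetP => i k _ _ ik; apply/seteqP; split=> // x.
      move=> [/A'A xi /A'A xk].
      by move/trivIsetP : tA => /(_ i k Logic.I Logic.I ik) <-.
    + move=> k; rewrite /A'; case: ifP => // _.
      by rewrite lt0e measure_ge0 andbT; apply/eqP.
  - exact: measurableD.
  - move=> k; apply/seteqP; split=> // x.
    rewrite /A'; case: eqP => [_ [? []//]|kj].
    move=> [xk [xj _]]; move/trivIsetP : tA => /(_ k j Logic.I Logic.I).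
    by move=> <-//; exact/eqP.
have mU := bigcup_ord_measurable mA.
apply/eqP; apply: contrapT => U0; apply: max.
apply: (nonnull_family_extend fA (measurableC mU)).
  by rewrite lt0e measure_ge0 andbT; apply/negP.
by move=> k; apply/seteqP; split=> // x [Ax]; apply; exists k.
Qed.

Lemma exists_maximal_nonnull_family N :
  (forall m (B : 'I_m -> set T), nonnull_family B -> (m <= N)%N) ->
  exists m (A : 'I_m -> set T),
    nonnull_family A /\ ~ (exists B : 'I_m.+1 -> set T, nonnull_family B).
Proof.
move=> bd; apply: contrapT => nex.
have all_m m : exists B : 'I_m -> set T, nonnull_family B.
  elim: m => [|m [B fB]].
    by exists (fun=> set0); split=> [[]//||[]//]; apply/trivIsetP => -[].
  by apply: contrapT => nB; apply: nex; exists m, B.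
by have [B /bd] := all_m N.+1; rewrite ltnn.
Qed.

(** The integrand agrees almost everywhere with its product by the step
    function equal to [1] on all the [A j]. *)
Lemma integral_bigcup_null (p' : probability T R) m (A : 'I_m -> set T)
    (u : T -> R) :
  (forall j, measurable (A j)) -> trivIset setT A ->
  p' (~` \bigcup_j A j) = 0%E -> p'.-integrable setT (EFin \o u) ->
  (\int[p']_x (u x)%:E = (\sum_j \int[p']_(x in A j) u x)%R%:E)%E.
Proof.
move=> mA tA N0 iu.
have mU := bigcup_ord_measurable mA.
have mu : measurable_fun setT u.
  by apply/measurable_EFinP; apply: measurable_int iu.
have -> : \sum_j \int[p']_(x in A j) u x =
    \sum_j 1 * \int[p']_(x in A j) u x by apply: eq_bigr => j _; rewrite mul1r.
rewrite -(integral_step mA (fun=> 1) iu); apply: ae_eq_integral => //.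
- exact: measurable_int iu.
- by apply/measurable_EFinP/measurable_funM => //; exact: measurable_step.
exists (~` \bigcup_j A j); split=> //; first exact: measurableC.
move=> x /= + [j _ Ajx]; apply => _.
by rewrite (stepE (fun=> 1) tA Ajx) mulr1.
Qed.

Lemma measure_bigcup_null (p' : probability T R) m (A : 'I_m -> set T) B :
  (forall j, measurable (A j)) -> trivIset setT A ->
  p' (~` \bigcup_j A j) = 0%E -> measurable B ->
  p' B = (\sum_j p' (A j `&` B))%E.
Proof.
move=> mA tA N0 mB.
have iB : p'.-integrable setT (EFin \o (\1_B : T -> R)).
  exact: integrable_indic.
have := integral_bigcup_null mA tA N0 iB; rewrite integral_indic// setIT => ->.
rewrite -sumEFin; apply: eq_bigr => j _.
rewrite /Rintegral integral_indic// setIC fineK// fin_num_measure//.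
exact: measurableI.
Qed.

End disjoint_families.

Section extreme_decomposition.
Context d (T : measurableType d) (R : realType).
Variables (n : nat) (f : 'I_n -> T -> R) (a : 'I_n -> R) (p : probability T R).

(** [m] independent vectors of a space of dimension [n + 1]. *)
Lemma extreme_nonnull_family_le m (B : 'I_m -> set T) :
  extreme_point (moment_set f a) p -> nonnull_family p B -> (m <= n.+1)%N.
Proof.
move=> ext [mB tB pB].
suff <- : \rank (col_mx (\row_k fine (p (B k)))
    (\matrix_(i < n, k < m) \int[p]_(x in B k) f i x)) = m.
  exact: rank_leq_row.
apply/rank_col_mxP => c c1 cf.
apply: (extreme_disjoint_indep ext mB tB pB).
  by rewrite -[RHS]c1; apply: eq_bigr => k _; rewrite mxE.
by move=> i; rewrite -[RHS](cf i); apply: eq_bigr => k _; rewrite mxE.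
Qed.

Lemma atom_matrix_rankP m (A : 'I_m -> set T) :
  \rank (atom_matrix p f A) = m <->
  forall c : 'I_m -> R, \sum_j c j = 0 ->
    (forall i, \sum_j c j * atom_value p (A j) (f i) = 0) -> forall j, c j = 0.
Proof.
rewrite /atom_matrix; split=> [/rank_col_mxP + c c1 cf|indep].
  apply; first by rewrite -[RHS]c1; apply: eq_bigr => k _; rewrite mxE mulr1.
  by move=> i; rewrite -[RHS](cf i); apply: eq_bigr => k _; rewrite mxE.
apply/rank_col_mxP => c c1 cf; apply: indep.
  by rewrite -[RHS]c1; apply: eq_bigr => k _; rewrite mxE mulr1.
by move=> i; rewrite -[RHS](cf i); apply: eq_bigr => k _; rewrite mxE.
Qed.

(** The coefficients are [alpha j = p (A j)].  A relation [c] between the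
    columns of [atom_matrix] becomes the relation [c j / p (A j)] between the
    vectors of [extreme_disjoint_indep], because [int_(A j) f i] is the value
    of [f i] on the atom times [p (A j)]. *)
Lemma extreme_atomic : extreme_point (moment_set f a) p ->
  exists m (alpha : 'I_m -> R) (A : 'I_m -> set T),
    atomic_decomposition p f alpha A.
Proof.
move=> ext; have [Mp _] := ext; have mf := moment_set_measurable Mp.
have [m [A [fA max]]] :=
  exists_maximal_nonnull_family
    (fun m B => extreme_nonnull_family_le (m := m) (B := B) ext).
have [mA tA pA] := fA; have [atA N0] := maximal_nonnull_family fA max.
have Afin j : p (A j) \is a fin_num by exact: fin_num_measure.
have fpA j : 0 < fine (p (A j)) by rewrite fine_gt0// pA ltey_eq Afin.
exists m, (fun j => fine (p (A j))), A; split=> //.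
- move=> B mB; rewrite (measure_bigcup_null mA tA N0 mB).
  apply: eq_bigr => j _; rewrite fineK// /cond_prob muleC -muleA mulVe ?mule1//.
  by rewrite gt_eqF.
- apply/atom_matrix_rankP => c c1 cf j.
  suff /eqP : c j / fine (p (A j)) = 0.
    by rewrite mulf_eq0 invr_eq0 (gt_eqF (fpA j)) orbF => /eqP.
  apply: (extreme_disjoint_indep
    (c := fun k => c k / fine (p (A k))) ext mA tA pA).
    rewrite -[RHS]c1; apply: eq_bigr => k _.
    by rewrite mulfVK// gt_eqF.
  move=> i; rewrite -[RHS](cf i); apply: eq_bigr => k _.
  rewrite /Rintegral (@atom_value_integral _ _ _ p p)//.
  by rewrite fineM//= [atom_value _ _ _ * _]mulrC mulrA mulfVK// gt_eqF.
Qed.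

(** A competitor [p'] has the same null sets inside each atom, so only the
    masses [p' (A j)] are free; mass and moments form a linear system for them
    with matrix [atom_matrix], whose columns are independent. *)
Lemma atomic_minimal m (alpha : 'I_m -> R) (A : 'I_m -> set T) :
  moment_set f a p -> atomic_decomposition p f alpha A ->
  ll_minimal (moment_set f a) p.
Proof.
move=> Mp [_ atA tA pE /atom_matrix_rankP indep].
split=> // -[p' [Mp' p'p dom]].
have mf := moment_set_measurable Mp.
have mA j : measurable (A j) by have [] := atA j.
have mU := bigcup_ord_measurable mA.
have N0 : p (~` \bigcup_j A j) = 0%E.
  rewrite pE; last exact: measurableC.
  apply: big1 => j _; rewrite /cond_prob.
  rewrite (_ : _ `&` _ = set0) ?measure0 ?mul0e ?mule0//.
  by apply/seteqP; split=> // x [Ax]; apply; exists j.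
have dom0 := (null_content_dominatesP _ _).1 dom.
have N'0 : p' (~` \bigcup_j A j) = 0%E by apply: dom0 => //; exact: measurableC.
have total (q : probability T R) : q (~` \bigcup_j A j) = 0%E ->
    \sum_j fine (q (A j)) = 1.
  move=> q0; have := integral_bigcup_null mA tA q0
    (finite_measure_integrable_cst q 1 measurableT).
  rewrite /= integral_cst// mul1e [X in X = _](probability_setT q) => -[->].
  by apply: eq_bigr => j _; rewrite Rintegral_cst// mul1r.
have moment (q : probability T R) i : moment_set f a q -> q `<< p ->
    q (~` \bigcup_j A j) = 0%E ->
    \sum_j fine (q (A j)) * atom_value p (A j) (f i) = a i.
  move=> Mq qp q0; have [ifi ai] := Mq i.
  have := integral_bigcup_null mA tA q0 ifi; rewrite ai => -[->].
  apply: eq_bigr => j _.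
  rewrite /Rintegral (atom_value_integral (atA j) (mf i) qp).
  by rewrite fineM ?fin_num_measure// mulrC.
have eqA j : p' (A j) = p (A j).
  have : fine (p' (A j)) - fine (p (A j)) = 0.
    apply: (indep (fun j => fine (p' (A j)) - fine (p (A j)))).
      by rewrite sumrB !total// subrr.
    move=> i; under eq_bigr do rewrite mulrBl.
    by rewrite sumrB !moment// subrr.
  move/eqP; rewrite subr_eq0 => /eqP e.
  by rewrite -[LHS]fineK ?fin_num_measure// e fineK ?fin_num_measure.
apply: p'p => B mB.
rewrite [LHS](measure_bigcup_null mA tA N'0 mB).
rewrite [RHS](measure_bigcup_null mA tA N0 mB).
apply: eq_bigr => j _; have [_ _ /(_ (A j `&` B))] := atA j.
case; [exact: measurableI|exact: subIsetl| |] => pAB.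
  by rewrite pAB; apply: dom0 => //; exact: measurableI.
have D0 : p' (A j `\` B) = 0%E.
  by apply: dom0; [exact: measurableD|exact: measureD_null].
by rewrite (measureI_null (mA j) mB D0) pAB eqA.
Qed.

End extreme_decomposition.

(** * Convex functions on the half-line *)

Section convexity.
Context (R : realType) (phi : R -> R).
Hypothesis cvx : convex_function (E := R^o) [set s : R | 0 <= s] phi.

Lemma convex_ineq x y t : 0 <= x -> 0 <= y -> 0 <= t <= 1 ->
  phi (t * x + (1 - t) * y) <= t * phi x + (1 - t) * phi y.
Proof.
move=> x0 y0 /andP[t0 t1].
have := cvx (Itv01 t0 t1) (mem_set (x0 : [set s : R | 0 <= s] x))
  (mem_set (y0 : [set s : R | 0 <= s] y)).
by [].
Qed.

(** The slope is the supremum of the slopes of the chords that end at [1]; it is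
    finite because [1] is interior to the half-line, so that a chord starting
    at [1] gives an upper bound. *)
Lemma convex_support1 : exists c, forall t, 0 <= t ->
  phi 1 + c * (t - 1) <= phi t.
Proof.
pose S := [set (phi 1 - phi s) / (1 - s) | s in [set s : R | 0 <= s < 1]].
have slope s t : 0 <= s < 1 -> 1 < t ->
    (phi 1 - phi s) / (1 - s) <= (phi t - phi 1) / (t - 1).
  move=> /andP[s0 s1] t1.
  have ts : 0 < t - s by lra.
  pose l := (t - 1) / (t - s).
  have l01 : 0 <= l <= 1.
    by rewrite divr_ge0 ?ler_pdivrMr ?mul1r//=; lra.
  have lE : l * (t - s) = t - 1 by rewrite /l divfK// gt_eqF.
  have := convex_ineq s0 (_ : 0 <= t) l01.
  rewrite (_ : l * s + _ = 1); last first.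
    by rewrite -[RHS](subKr t) -lE; ring.
  move=> /(_ (ltW (lt_trans ltr01 t1))) h.
  rewrite ler_pdivrMr ?subr_gt0// mulrAC ler_pdivlMr ?subr_gt0//.
  have : (t - s) * phi 1 <= (t - s) * (l * phi s + (1 - l) * phi t).
    by rewrite ler_pM2l.
  have -> : (t - s) * (l * phi s + (1 - l) * phi t) =
    l * (t - s) * phi s + (t - s - l * (t - s)) * phi t by ring.
  by rewrite lE; lra.
have S0 : S !=set0 by exists ((phi 1 - phi 0) / (1 - 0)); exists 0 => //=; lra.
have ubS t : 1 < t -> ubound S ((phi t - phi 1) / (t - 1)).
  by move=> t1 _ [s /= s01 <-]; exact: slope.
have hubS : has_ubound S by exists ((phi 2 - phi 1) / (2 - 1)); apply: ubS; lra.
exists (sup S) => t t0.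
have [t1|t1|->] := ltgtP t 1; last by rewrite subrr mulr0 addr0.
- have : (phi 1 - phi t) / (1 - t) <= sup S.
    by apply: ub_le_sup => //; exists t => //=; rewrite t0.
  rewrite ler_pdivrMr ?subr_gt0//; lra.
- have : sup S <= (phi t - phi 1) / (t - 1) by apply: ge_sup => //; exact: ubS.
  rewrite ler_pdivlMr ?subr_gt0//; lra.
Qed.

(** Sublevel sets of a convex function are intervals; [phi] may be discontinuous
    at [0]. *)
Lemma convex_measurable : measurable_fun [set s : R | 0 <= s] phi.
Proof.
have mD : measurable [set s : R | 0 <= s].
  rewrite (_ : [set _ | _] = `[0, +oo[%classic) //.
  by apply/seteqP; split=> x /=; rewrite in_itv/= andbT.
apply: (measurability _ (RGenOInfty.measurableE R)) => //.
move=> /= _ [_ [r ->] <-].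
have -> : [set s : R | 0 <= s] `&` phi @^-1` `]r, +oo[ =
    [set s : R | 0 <= s] `\` [set s : R | 0 <= s /\ phi s <= r].
  apply/seteqP; split=> s /=; rewrite in_itv/= andbT ltNge.
    by move=> [s0 /negP h]; split=> // -[_]; exact: h.
  by move=> [s0 h]; split=> //; apply/negP => h'; apply: h.
apply: measurableD => //; apply: is_interval_measurable.
move=> x y [x0 xr] [y0 yr] z /andP[xz zy]; split; first exact: le_trans xz.
have [xy|xy] := eqVneq x y.
  by have <- : x = z by apply/eqP; rewrite eq_le xz xy zy.
have xy0 : 0 < y - x by rewrite subr_gt0 lt_neqAle xy (le_trans xz).
pose t := (y - z) / (y - x).
have t01 : 0 <= t <= 1 by rewrite divr_ge0 ?ler_pdivrMr ?mul1r//=; lra.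
have tE : t * (y - x) = y - z by rewrite /t divfK// gt_eqF.
have := convex_ineq x0 y0 t01; rewrite (_ : t * x + _ = z); last first.
  by rewrite -[RHS](subKr y) -tE; ring.
move/le_trans; apply; move: t01 => /andP[t0 t1].
have : t * phi x <= t * r by rewrite ler_wpM2l.
have : (1 - t) * phi y <= (1 - t) * r by rewrite ler_wpM2l// subr_ge0.
lra.
Qed.

Lemma measurable_convex_comp d (T : measurableType d) (g : T -> R) :
  measurable_fun setT g -> (forall x, 0 <= g x) ->
  measurable_fun setT (phi \o g).
Proof.
move=> mg g0; apply: (measurable_comp _ _ convex_measurable mg).
  rewrite (_ : [set _ | _] = `[0, +oo[%classic) //.
  by apply/seteqP; split=> x /=; rewrite in_itv/= andbT.
by move=> _ [x _ <-] /=.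
Qed.

End convexity.

Section integrability.
Context d (T : measurableType d) (R : realType).
Variable mu : {measure set T -> \bar R}.

Lemma integrable_sandwich (l g u : T -> R) : measurable_fun setT g ->
  mu.-integrable setT (EFin \o l) -> mu.-integrable setT (EFin \o u) ->
  (forall x, l x <= g x <= u x) -> mu.-integrable setT (EFin \o g).
Proof.
move=> mg il iu lgu.
have inorm (v : T -> R) : mu.-integrable setT (EFin \o v) ->
  mu.-integrable setT (EFin \o (fun x => `|v x|)) by exact: integrable_norm.
have := integrableD measurableT (inorm l il) (inorm u iu).
apply: le_integrable => //; first exact/measurable_EFinP.
move=> x _ /=; rewrite lee_fin [leRHS]ger0_norm ?addr_ge0//.
have /andP[lg gu] := lgu x; rewrite ler_norml; apply/andP; split.
  by have := normr_ge0 (u x); have := lerNnormlW (lexx `|l x|); lra.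
by have := normr_ge0 (l x); have := ler_norm (u x); lra.
Qed.

Lemma integrable_lower_bound (l g : T -> R) : measurable_fun setT g ->
  mu.-integrable setT (EFin \o l) -> (forall x, l x <= g x) ->
  (\int[mu]_x (g x)%:E < +oo)%E -> mu.-integrable setT (EFin \o g).
Proof.
move=> mg il lg ig.
have mEg : measurable_fun setT (EFin \o g) by exact/measurable_EFinP.
have neg : (\int[mu]_x ((EFin \o g)^\- x) < +oo)%E.
  have := integral_funeneg_lt_pinfty measurableT il.
  apply: le_lt_trans; apply: ge0_le_integral => //.
  - exact: measurable_funeneg.
  - by apply: measurable_funeneg; exact: measurable_int il.
  - move=> x _; rewrite !funerneg /= lee_fin /funrneg.
    by rewrite ge_max !le_max lerN2 lg lexx orbT.
have neg0 : (0 <= \int[mu]_x ((EFin \o g)^\- x))%E by exact: integral_ge0.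
have pos : (\int[mu]_x ((EFin \o g)^\+ x) < +oo)%E.
  move: ig; rewrite integralE -/(EFin \o g).
  move: neg neg0; case: (\int[mu]_x ((EFin \o g)^\- x))%E => //= r _ _.
  by case: (\int[mu]_x ((EFin \o g)^\+ x))%E => [s|//|]; rewrite ?ltry.
apply/integrableP; split=> //.
rewrite -[fun x => _]/(abse \o (EFin \o g)) fune_abse ge0_integralD//.
- exact: lte_add_pinfty.
- exact: measurable_funepos.
- exact: measurable_funeneg.
Qed.

End integrability.

(** * Divergences along a segment *)

Section divergence.
Context d (T : measurableType d) (R : realType) (p q : probability T R).
Variable phi : R -> R.
Hypotheses (pq : p `<< q)
  (cvx : convex_function (E := R^o) [set s : R | 0 <= s] phi).

Lemma phi_divergenceE :
  phi_divergence phi p q = (\int[q]_x (phi (dens p q x))%:E)%E.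
Proof. by []. Qed.

Lemma measurable_phi_dens : measurable_fun setT (phi \o dens p q).
Proof.
apply: measurable_convex_comp => //; first exact: measurable_dens.
exact: dens_ge0.
Qed.

Lemma affine_dens_integrable (b c : R) :
  q.-integrable setT (EFin \o (fun x => b + c * (dens p q x - 1))).
Proof.
have -> : EFin \o (fun x => b + c * (dens p q x - 1)) =
    (fun x => (b - c)%:E + c%:E * (dens p q x)%:E)%E.
  by apply/funext => x /=; rewrite -EFinM -EFinD; congr EFin; ring.
apply: integrableD => //; first exact: finite_measure_integrable_cst.
exact/integrableZl/dens_integrable.
Qed.

Lemma affine_dens_integral (b c : R) :
  (\int[q]_x (b + c * (dens p q x - 1))%:E = b%:E)%E.
Proof.
under eq_integral.
  move=> x _; rewrite (_ : b + _ = (b - c) + c * dens p q x); last by ring.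
  rewrite EFinD EFinM; over.
rewrite integralD//; last 2 first.
- exact: finite_measure_integrable_cst.
- exact/integrableZl/dens_integrable.
rewrite integral_cst// integralZl//; last exact: dens_integrable.
rewrite -(dens_integral pq measurableT).
rewrite [X in (_ * X + _)%E](probability_setT q).
rewrite [X in (_ + _ * X)%E](probability_setT p).
by rewrite !mule1 -EFinD subrK.
Qed.

(** The support line at [1] gives an integrable lower bound, so a divergence
    smaller than [+oo] is finite. *)
Lemma phi_dens_integrable : (phi_divergence phi p q < +oo)%E ->
  q.-integrable setT (EFin \o (phi \o dens p q)).
Proof.
move=> D; have [c hc] := convex_support1 cvx.
apply: (integrable_lower_bound measurable_phi_dens
  (affine_dens_integrable (phi 1) c)) => // x.
by apply: hc; exact: dens_ge0.
Qed.

(** Jensen's inequality: the support line at [1] integrates to [phi 1], since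
    a density has mean [1]. *)
Lemma phi_divergence_ge : (phi_divergence phi p q < +oo)%E ->
  ((phi 1)%:E <= phi_divergence phi p q)%E.
Proof.
move=> D; have [c hc] := convex_support1 cvx.
rewrite -(affine_dens_integral (phi 1) c) phi_divergenceE.
apply: le_integral => //; first exact: affine_dens_integrable.
  exact: phi_dens_integrable.
by move=> x _; rewrite lee_fin; apply: hc; exact: dens_ge0.
Qed.

End divergence.

Section divergence_path.
Context d (T : measurableType d) (R : realType) (p p' q : probability T R).
Variable phi : R -> R.
Hypotheses (pq : p `<< q) (p'q : p' `<< q)
  (cvx : convex_function (E := R^o) [set s : R | 0 <= s] phi)
  (Dp : (phi_divergence phi p q < +oo)%E)
  (Dp' : (phi_divergence phi p' q < +oo)%E).

Let F (l : R) (x : T) : R := phi (l * dens p q x + (1 - l) * dens p' q x).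

Let mix_ge0 l x : 0 <= l <= 1 -> 0 <= l * dens p q x + (1 - l) * dens p' q x.
Proof.
by move=> /andP[l0 l1]; rewrite addr_ge0// mulr_ge0 ?dens_ge0// subr_ge0.
Qed.

Let mF l : 0 <= l <= 1 -> measurable_fun setT (F l).
Proof.
move=> l01; apply: (measurable_convex_comp cvx
  (g := fun x => l * dens p q x + (1 - l) * dens p' q x)).
  apply: measurable_funD; apply: measurable_funM => //;
    exact: measurable_dens.
by move=> x; exact: mix_ge0.
Qed.

Lemma div_pathE l : 0 <= l <= 1 ->
  div_path phi p p' q l =
  (\int[q]_x (phi (l * dens p q x + (1 - l) * dens p' q x))%:E)%E.
Proof.
move=> l01; rewrite /div_path phi_divergenceE.
have dom := mixture_dominated l pq p'q.
apply: ae_eq_integral => //.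
- by apply/measurable_EFinP; exact: (measurable_phi_dens dom cvx).
- by apply/measurable_EFinP; exact: mF.
by apply: filterS (dens_mixture pq p'q l01) => x /= /[apply] ->.
Qed.

Lemma phi_mix_le l x : 0 <= l <= 1 ->
  phi (l * dens p q x + (1 - l) * dens p' q x) <=
  l * phi (dens p q x) + (1 - l) * phi (dens p' q x).
Proof. by move=> l01; apply: convex_ineq => //; exact: dens_ge0. Qed.

(** Bounded below by the support line at [1] and above by convexity. *)
Lemma phi_mix_integrable l : 0 <= l <= 1 -> q.-integrable setT
  (EFin \o (fun x => phi (l * dens p q x + (1 - l) * dens p' q x))).
Proof.
move=> l01; have [c hc] := convex_support1 cvx.
apply: (integrable_sandwich (mF l01)
  (l := fun x => phi 1 + c * (l * dens p q x + (1 - l) * dens p' q x - 1))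
  (u := fun x => l * phi (dens p q x) + (1 - l) * phi (dens p' q x))).
- pose h (r : probability T R) x := phi 1 + c * (dens r q x - 1).
  have -> : EFin \o (fun x =>
      phi 1 + c * (l * dens p q x + (1 - l) * dens p' q x - 1)) =
      (fun x => l%:E * (h p x)%:E + (1 - l)%:E * (h p' x)%:E)%E.
    by apply/funext => x; rewrite /h /= -!EFinM -EFinD; congr EFin; ring.
  by apply: integrableD => //; apply: integrableZl => //;
    exact: affine_dens_integrable.
- have -> : EFin \o (fun x =>
      l * phi (dens p q x) + (1 - l) * phi (dens p' q x)) =
    (fun x => l%:E * (phi (dens p q x))%:E
              + (1 - l)%:E * (phi (dens p' q x))%:E)%E.
    by apply/funext => x; rewrite /= -!EFinM -EFinD.
  by apply: integrableD => //; apply: integrableZl => //;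
    exact: phi_dens_integrable.
- by move=> x; rewrite phi_mix_le// andbT; apply: hc; exact: mix_ge0.
Qed.

Lemma div_path_lty l : 0 <= l <= 1 -> (div_path phi p p' q l < +oo)%E.
Proof.
by move=> l01; rewrite div_pathE// integrable_lty//; exact: phi_mix_integrable.
Qed.

Lemma div_path_ge l : 0 <= l <= 1 -> ((phi 1)%:E <= div_path phi p p' q l)%E.
Proof.
move=> l01; apply: phi_divergence_ge => //; last exact: div_path_lty.
exact: mixture_dominated.
Qed.

Lemma div_path1 : div_path phi p p' q 1 = phi_divergence phi p q.
Proof.
rewrite div_pathE ?ler01 ?lexx//; apply: eq_integral => x _.
by rewrite mul1r subrr mul0r addr0.
Qed.

Lemma div_path_incrE l : 0 <= l <= 1 ->
  (div_path phi p p' q l - phi_divergence phi p q =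
  (\int[q]_x (phi (l * dens p q x + (1 - l) * dens p' q x)
              - phi (dens p q x)))%R%:E)%E.
Proof.
move=> l01; rewrite div_pathE// phi_divergenceE -integralB//; last 2 first.
- exact: phi_mix_integrable.
- exact: phi_dens_integrable.
rewrite /Rintegral fineK//.
exact: (integrable_fin_num measurableT (integrableB measurableT
  (phi_mix_integrable l01) (phi_dens_integrable pq cvx Dp))).
Qed.

Lemma descent_strict_local_max : infinite_descent phi p p' q ->
  strict_local_max_at1 (div_path phi p p' q).
Proof.
move=> /cvgeNyPlt/(_ 0) /nbhs_ballP[e /= e0 He].
exists e => // l l01 /andP[le l1].
have l1' : 0 < 1 - l by rewrite subr_gt0.
have := He l; rewrite /ball /= gtr0_norm// => /(_ _ l1); rewrite div_path1.
move=> /(_ (ltac:(lra))).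
have := div_path_incrE l01; have := div_path_lty l01; have := div_path_ge l01.
case: (div_path phi p p' q l) => // D _ _.
have := phi_divergence_ge pq cvx Dp.
case: (phi_divergence phi p q) Dp => // D' _ _ _.
rewrite inver (gt_eqF l1') -EFinB -EFinM !lte_fin.
by rewrite ltr_pdivrMr// mul0r subr_lt0.
Qed.

End divergence_path.

(** * Infinite descent towards a non-dominating endpoint *)

Section descent.
Context d (T : measurableType d) (R : realType) (p p' q : probability T R).
Variable phi : R -> R.
Hypotheses (pq : p `<< q) (p'q : p' `<< q).

Let x_ := dens p q.
Let y_ := dens p' q.
Let mx : measurable_fun setT x_ := measurable_dens pq.
Let my : measurable_fun setT y_ := measurable_dens p'q.

(* The upper bound on the density of [p'] makes the argument of [phi] go to 0
   uniformly on [W k], and the lower bound makes the descent uniform. *)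
Let W (k : nat) : set T :=
  [set t | x_ t = 0] `&` [set t | k.+1%:R^-1 < y_ t < k.+1%:R].

Let mW k : measurable (W k).
Proof.
apply: measurableI.
  rewrite (_ : [set _ | _] = x_ @^-1` [set 0]) // -[X in measurable X]setTI.
  exact: mx.
rewrite (_ : [set _ | _] = y_ @^-1` `]k.+1%:R^-1, k.+1%:R[).
  by rewrite -[X in measurable X]setTI; exact: my.
by apply/seteqP; split=> t /=; rewrite in_itv.
Qed.

(** Some [N] has [p N = 0] and [p' N > 0]. On [N], [x_] vanishes [q]-almost
    everywhere, hence also [p']-almost everywhere, and [y_] is positive
    [p']-almost everywhere; so [N] is covered, up to a [p']-null set, by the
    countably many sets [W k]. *)
Lemma singular_slab : ~ p' `<< p -> exists k, (0 < q (W k))%E.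
Proof.
move=> np'p; apply: contrapT => nW; apply: np'p.
have W0 k : q (W k) = 0%E.
  apply/eqP; apply: contrapT => Wk; apply: nW; exists k.
  by rewrite lt0e measure_ge0 andbT; apply/negP.
have p'q0 := (null_content_dominatesP _ _).1 p'q.
apply/null_content_dominatesP => N mN pN.
have x0N : ae_eq q N (EFin \o x_) (cst 0%E).
  apply/ae_eq_integral_abs => //; first exact/measurable_EFinP/measurable_funTS.
  rewrite -[RHS](etrans (esym (dens_integral pq mN)) pN).
  apply: eq_integral => t _.
  by rewrite /= ger0_norm// dens_ge0.
have x0N' : p'.-negligible (N `&` [set t | x_ t != 0]).
  have [Z [mZ Z0 ZN]] := null_dominates_ae_eq mN p'q x0N.
  exists Z; split=> // t [Nt /= xt]; apply: ZN => /= /(_ Nt) [] /eqP.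
  exact/negP.
have mY : measurable [set t | y_ t = 0].
  rewrite (_ : [set _ | _] = y_ @^-1` [set 0]) // -[X in measurable X]setTI.
  exact: my.
have y0 : p' [set t | y_ t = 0] = 0%E.
  rewrite (dens_integral p'q mY) (eq_integral (cst 0%E)) ?integral0//.
  by move=> t /set_mem /= yt; rewrite -/y_ yt.
apply/negligibleP => //.
apply: (@negligibleS _ _ _ _ ((N `&` [set t | x_ t != 0]) `|`
    ([set t | y_ t = 0] `|` \bigcup_k W k))); last first.
  apply: negligibleU => //; apply: negligibleU; first exact/negligibleP.
  by apply: negligible_bigcup => k; apply/negligibleP => //; exact: p'q0 (W0 k).
move=> t Nt; have [xt|xt] := eqVneq (x_ t) 0; last by left.
right; have [yt|yt] := eqVneq (y_ t) 0; first by left.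
have yt0 : 0 < y_ t by rewrite lt_neqAle eq_sym yt dens_ge0.
right; exists (maxn (Num.truncn (y_ t)) (Num.truncn (y_ t)^-1)) => //.
split=> //=; apply/andP; split.
  rewrite invf_plt ?posrE// (lt_le_trans (truncnS_gt _))// ler_nat ltnS.
  exact: leq_maxr.
by rewrite (lt_le_trans (truncnS_gt _))// ler_nat ltnS leq_maxl.
Qed.

(** On [W k] the increment of [phi] between [l = 1] and [l] is
    [phi ((1 - l) * y_) - phi 0 <= - K * (1 - l) / M] for [l] close to 1;
    outside, convexity bounds it by [(1 - l) * (phi y_ - phi x_)], whose
    integral is [(1 - l) * C]. The constant [K] is arbitrary. *)
Lemma singular_infinite_descent : ~ p' `<< p ->
  convex_function (E := R^o) [set s : R | 0 <= s] phi ->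
  right_derivative0_is_Ny phi ->
  (phi_divergence phi p q < +oo)%E -> (phi_divergence phi p' q < +oo)%E ->
  infinite_descent phi p p' q.
Proof.
move=> /singular_slab[k Wk] cvx der Dp Dp'.
set M : R := k.+1%:R in Wk.
have M0 : 0 < M by rewrite ltr0n.
have Wfin : q (W k) \is a fin_num by exact: fin_num_measure.
have w0 : 0 < fine (q (W k)) by rewrite fine_gt0// Wk ltey_eq Wfin.
have mWc : measurable (~` W k) by exact: measurableC.
pose C := \int[q]_(t in ~` W k) (phi (y_ t) - phi (x_ t)).
apply/cvgeNyPle => A.
(* Chosen so that the descent on [W k] compensates both [C] and [A]. *)
pose K := (`|C| + `|A|) * M / fine (q (W k)).
have K0 : 0 <= K.
  by rewrite mulr_ge0 ?invr_ge0 ?(ltW w0)// mulr_ge0 ?(ltW M0)// addr_ge0.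
have KE : K * M^-1 * fine (q (W k)) = `|C| + `|A|.
  by rewrite /K mulrAC divfK ?gt_eqF// mulfK// gt_eqF.
move: der => /cvgeNyPle/(_ (- K)) /nbhs_ballP[s0 /= s00 Hs].
have slope s : 0 < s < s0 -> phi s - phi 0 <= - K * s.
  move=> /andP[sp ss0]; have := Hs s.
  rewrite /ball /= sub0r normrN gtr0_norm// => /(_ ss0 sp).
  by rewrite lee_fin ler_pdivrMr.
near=> l.
have l0 : 0 < l by near: l; exact: nbhs_left_gt.
have l1 : l < 1 by near: l; exact: nbhs_left_lt.
have ls0 : 1 - l < s0 / M by near: l; apply: nbhs_left_ltBl; exact: divr_gt0.
have l01 : 0 <= l <= 1 by rewrite !ltW.
have l1' : 0 < 1 - l by rewrite subr_gt0.
have ip := phi_dens_integrable pq cvx Dp.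
have ip' := phi_dens_integrable p'q cvx Dp'.
have im := phi_mix_integrable pq p'q cvx Dp Dp' l01.
pose G t := phi (l * x_ t + (1 - l) * y_ t) - phi (x_ t).
have iG : q.-integrable setT (EFin \o G) := integrableB measurableT im ip.
rewrite div_path_incrE// inver (gt_eqF l1') -EFinM lee_fin ler_pdivrMr//.
rewrite -/(G _) -(setvU (W k)) Rintegral_setU//; last 2 first.
- by rewrite setvU.
- by apply/disj_set2P; rewrite setICl.
have offW : \int[q]_(t in ~` W k) G t <= (1 - l) * C.
  have iC : q.-integrable (~` W k) (EFin \o (fun t => phi (y_ t) - phi (x_ t))).
    apply: (integrableS measurableT) => //.
    exact: (integrableB measurableT ip' ip).
  rewrite /C -RintegralZl//; apply: le_Rintegral => //.
  - exact: (integrableS measurableT).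
  - exact: (integrableZl mWc (1 - l) iC).
  move=> t _; have := phi_mix_le pq p'q cvx t l01.
  by rewrite /G -/x_ -/y_; lra.
have onW : \int[q]_(t in W k) G t <= - K * ((1 - l) / M) * fine (q (W k)).
  rewrite -Rintegral_cst//; apply: le_Rintegral => //.
  - exact: (integrableS measurableT).
  - exact: finite_measure_integrable_cst.
  move=> t [/= xt /andP[yM My]]; rewrite /G xt mulr0 add0r.
  have yt0 : 0 < y_ t by rewrite (lt_trans _ yM)// invr_gt0.
  apply: (@le_trans _ _ (- K * ((1 - l) * y_ t))).
    apply: slope; rewrite mulr_gt0//=.
    rewrite (lt_trans (_ : _ < (1 - l) * M))// ?ltr_pM2l//.
    by rewrite -ltr_pdivlMr.
  rewrite !mulNr lerN2 ler_wpM2l// ler_wpM2l// ltW//.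
have -> : A * (1 - l) = (1 - l) * A by rewrite mulrC.
apply: (le_trans (lerD offW onW)).
have -> : - K * ((1 - l) / M) * fine (q (W k)) =
  (1 - l) * - (K * M^-1 * fine (q (W k))) by ring.
rewrite KE -mulrDr ler_pM2l//.
have := ler_norm C; have := ler_norm (- A); rewrite normrN; lra.
Unshelve. all: by end_near. Qed.

End descent.

(** * The generator [1 - sqrt t] *)

Section sqrt_deficit.
Context (R : realType).

(** The generator of (half) the squared Hellinger distance: its slope at [0] is
    [-oo], and it grows at most linearly in absolute value, so its divergence
    is finite for every dominated measure. *)
Definition sqrt_deficit (t : R) : R := 1 - Num.sqrt t.

Lemma sqrt_concave (u x y : R) : 0 <= u <= 1 -> 0 <= x -> 0 <= y ->
  u * Num.sqrt x + (1 - u) * Num.sqrt y <= Num.sqrt (u * x + (1 - u) * y).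
Proof.
move=> /andP[u0 u1] x0 y0; have v0 : 0 <= 1 - u by rewrite subr_ge0.
have := sqr_sqrtr x0; have := sqr_sqrtr y0.
have := sqrtr_ge0 x; have := sqrtr_ge0 y.
set a := Num.sqrt x; set b := Num.sqrt y => b0 a0 <- <-.
rewrite -[leLHS]ger0_norm ?addr_ge0 ?mulr_ge0// -sqrtr_sqr.
apply: ler_wsqrtr; rewrite -subr_ge0.
have -> : u * a ^+ 2 + (1 - u) * b ^+ 2 - (u * a + (1 - u) * b) ^+ 2 =
  u * (1 - u) * (a - b) ^+ 2 by ring.
by rewrite mulr_ge0 ?sqr_ge0// mulr_ge0.
Qed.

Lemma sqrt_deficit_convex :
  convex_function (E := R^o) [set s : R | 0 <= s] sqrt_deficit.
Proof.
move=> t x y /set_mem x0 /set_mem y0.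
have t01 : 0 <= t%:num <= 1 by rewrite ge0 le1.
have := sqrt_concave t01 x0 y0.
change (t%:num * Num.sqrt x + (1 - t%:num) * Num.sqrt y <=
    Num.sqrt (t%:num * x + (1 - t%:num) * y) ->
  1 - Num.sqrt (t%:num * x + (1 - t%:num) * y) <=
    t%:num * (1 - Num.sqrt x) + (1 - t%:num) * (1 - Num.sqrt y)).
move: (Num.sqrt _) (Num.sqrt _) (Num.sqrt _) => a b c; lra.
Qed.

Lemma sqrt_deficit_derivative0 : right_derivative0_is_Ny sqrt_deficit.
Proof.
apply/cvgeNyPle => A; near=> s.
have s0 : 0 < s by near: s; exact: nbhs_right_gt.
(* Below this threshold [A ^+ 2 * s <= 1], that is [|A| * s <= sqrt s]. *)
have sA : s < (1 + A ^+ 2)^-1.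
  by near: s; apply: nbhs_right_lt; rewrite invr_gt0 ltr_pwDl// sqr_ge0.
rewrite lee_fin ler_pdivrMr// /sqrt_deficit sqrtr0 subr0 addrAC subrr add0r.
rewrite lerNl -mulNr (le_trans (ler_norm _))// -sqrtr_sqr ler_wsqrtr//.
rewrite exprMn sqrrN (expr2 s) mulrA ler_piMl// ?ltW//.
have A0 : 0 < 1 + A ^+ 2 by rewrite ltr_pwDl// sqr_ge0.
have : s * (1 + A ^+ 2) < 1 by rewrite -ltr_pdivlMr// mul1r.
by rewrite mulrDr mulr1 => h; rewrite mulrC; lra.
Unshelve. all: by end_near. Qed.

Lemma sqrt_deficit_divergence_lty d (T : measurableType d)
    (p q : probability T R) :
  p `<< q -> (phi_divergence sqrt_deficit p q < +oo)%E.
Proof.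
move=> pq.
apply: (integrable_lty measurableT (f := EFin \o (sqrt_deficit \o dens p q))).
apply: (integrable_sandwich (l := fun x => - 1 + (- 1) * (dens p q x - 1))
  (u := fun x => 1 + 0 * (dens p q x - 1))).
- exact: (measurable_phi_dens pq sqrt_deficit_convex).
- exact: affine_dens_integrable.
- exact: affine_dens_integrable.
move=> x; have := dens_ge0 pq x.
rewrite /= /sqrt_deficit; set t := dens p q x => t0.
have := sqrtr_ge0 t; have := sqr_sqrtr t0; set s := Num.sqrt t => <- s0.
by apply/andP; split; have := sqr_ge0 (s - 1); nra.
Qed.

Lemma sqrt_deficit_divergence_self d (T : measurableType d)
    (p : probability T R) :
  phi_divergence sqrt_deficit p p = 0%E.
Proof.
have pp : p `<< p by [].
have d1 : ae_eq p setT (dens p p) (cst 1).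
  apply: ae_eq_dens => // A mA; by rewrite /= integral_cst// mul1e.
rewrite phi_divergenceE.
transitivity (\int[p]_x (cst 0%E x : \bar R))%E; last by rewrite integral0.
apply: ae_eq_integral => //.
  apply/measurable_EFinP.
  exact: (measurable_phi_dens pp sqrt_deficit_convex).
by apply: filterS d1 => x /= /[apply] ->; rewrite /sqrt_deficit sqrtr1 subrr.
Qed.

End sqrt_deficit.

(** * Minimality, descent and extremality *)

Section minimality.
Context d (T : measurableType d) (R : realType).
Variables (M : set (probability T R)) (p : probability T R).

Lemma minimal_descent : ll_minimal M p ->
  forall p' q phi, admissible M p p' q phi -> infinite_descent phi p p' q.
Proof.
move=> [Mp min] p' q phi [[Mp' p'p] [Mq pq p'q] cvx [phi1 der] [Dp Dp']].
by apply: singular_infinite_descent => // dom; apply: min; exists p'.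
Qed.

Lemma admissible_sqrt_deficit p' : M p -> M p' -> ~ (p' ≡μ p) -> p' `<< p ->
  admissible M p p' p (@sqrt_deficit R).
Proof.
move=> Mp Mp' p'p dom; have pp : p `<< p by [].
split; [by []|by split|exact: sqrt_deficit_convex| |].
- split; last exact: sqrt_deficit_derivative0.
  by rewrite /sqrt_deficit sqrtr1 subrr.
- by split; exact: sqrt_deficit_divergence_lty.
Qed.

(** With [q = p] the path starts from the minimum [D(p || p) = 0], so the
    difference quotient towards a dominated [p'] is nonnegative. *)
Lemma descent_minimal : M p ->
  (forall p' q phi, admissible M p p' q phi -> infinite_descent phi p p' q) ->
  ll_minimal M p.
Proof.
move=> Mp desc; split=> // -[p' [Mp' p'p dom]].
have pp : p `<< p by [].
have := desc _ _ _ (admissible_sqrt_deficit Mp Mp' p'p dom).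
move=> /cvgeNyPlt/(_ 0) neg.
have [l [l1 l0 lneg]] : exists l, [/\ l < 1, 0 < l &
  ((div_path (@sqrt_deficit R) p p' p l
    - phi_divergence (@sqrt_deficit R) p p) / (1 - l)%:E < 0)%E].
  apply: (@filter_ex _ ((1:R)^'-)); near=> l; split; near: l => //.
    exact: nbhs_left_lt.
  exact: nbhs_left_gt.
have l01 : 0 <= l <= 1 by rewrite !ltW.
have := div_path_ge pp dom (@sqrt_deficit_convex R)
  (sqrt_deficit_divergence_lty pp) (sqrt_deficit_divergence_lty dom) l01.
rewrite {1}/sqrt_deficit sqrtr1 subrr => D0.
move: lneg; rewrite sqrt_deficit_divergence_self sube0 ltNge mule_ge0//.
by rewrite inve_ge0 lee_fin subr_ge0 ltW.
Unshelve. all: by end_near. Qed.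

(** Both components of a proper mixture are dominated by the mixture. *)
Lemma minimal_extreme : ll_minimal M p -> extreme_point M p.
Proof.
move=> [Mp min]; split=> // p1 p2 l Mp1 Mp2 /andP[l0 l1] pE.
have l01 : 0 <= l <= 1 by rewrite !ltW.
have null A : measurable A -> p A = 0%E -> p1 A = 0%E /\ p2 A = 0%E.
  move=> mA pA; have := pE A mA.
  rewrite [X in X = _]pA [X in _ = X](mixtureE _ _ _ l01).
  move/esym/eqP; rewrite padde_eq0; last 2 first.
  - by rewrite mule_ge0// lee_fin ltW.
  - by rewrite mule_ge0// lee_fin subr_ge0 ltW.
  rewrite !mule_eq0 !eqe (gt_eqF l0) subr_eq0 (gt_eqF l1) /=.
  by move=> /andP[/eqP ? /eqP ?].
split; apply: contrapT => np; apply: min.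
  exists p1; split=> //; apply/null_content_dominatesP => A mA pA.
  by have [] := null A mA pA.
exists p2; split=> //; apply/null_content_dominatesP => A mA pA.
by have [] := null A mA pA.
Qed.

End minimality.

Theorem theorem3p2 (d : measure_display) (T : measurableType d) (R : realType)
    (n : nat) (n_ge1 : (1 <= n)%N)
    (f : 'I_n -> T -> R) (mf : forall i, measurable_fun setT (f i))
    (a : 'I_n -> R) (p : probability T R) (Mp : moment_set f a p) :
  [/\ [<-> extreme_point (moment_set f a) p;
           exists m (alpha : 'I_m -> R) (A : 'I_m -> set T),
             atomic_decomposition p f alpha A;
           ll_minimal (moment_set f a) p;
           forall p' q phi, admissible (moment_set f a) p p' q phi ->
             infinite_descent phi p p' q],
      (extreme_point (moment_set f a) p ->
        forall m (alpha : 'I_m -> R) (A : 'I_m -> set T),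
          atomic_decomposition p f alpha A -> (m <= n.+1)%N) &
      (forall p' q phi, admissible (moment_set f a) p p' q phi ->
        (forall l : R, 0 <= l <= 1 ->
           (0 <= div_path phi p p' q l < +oo)%E) /\
        (infinite_descent phi p p' q ->
           strict_local_max_at1 (div_path phi p p' q)))].
Proof.
split.
- tfae.
  + exact: extreme_atomic.
  + by move=> [m [alpha [A dec]]]; exact: atomic_minimal dec.
  + exact: minimal_descent.
  + by move=> desc; apply: minimal_extreme; exact: descent_minimal.
- by move=> _ m alpha A [_ _ _ _ <-]; exact: rank_leq_row.
- move=> p' q phi [_ [_ pq p'q] cvx [phi1 _] [Dp Dp']]; split=> [l l01|].
    rewrite div_path_lty// andbT -[X in (X <= _)%E]/(0%:E) -phi1.
    exact: div_path_ge.
  exact: descent_strict_local_max.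
Qed.
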